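(* Let $\varkappa\geq 2$ be an integer. Let $\{a_n\}_{n=0}^\infty$ be a Stieltjes moment sequence with a representing measure $\mu$, and suppose that $\{\sqrt[\varkappa]{a_n}\}_{n=0}^\infty$ is a Stieltjes moment sequence with a representing measure $\nu$. Suppose that $\mu((\vartheta_1,\vartheta_2))=0$ for some $\vartheta_1,\vartheta_2\in\mathbb{R}$ such that $0\leq\vartheta_1<\vartheta_2$. Set $\beta=\sqrt[\varkappa]{\vartheta_2}$, $\beta^\dag=\sqrt[\varkappa]{\vartheta_1}$ and, in the parts where $\vartheta_3$ is introduced, $\alpha=\frac{\vartheta_1}{\vartheta_3}\sqrt[\varkappa]{\vartheta_3}$, $\gamma=\sqrt[\varkappa]{\vartheta_3}$ and $\alpha^\dag=\frac{\vartheta_2}{\vartheta_3}\sqrt[\varkappa]{\vartheta_3}$. Then: (i) $\nu((\beta^\dag,\beta))=0$ provided that $\{a_n\}_{n=0}^\infty$ is determinate; (ii) $\nu((\alpha,\alpha^\dag))=0$ provided that $\vartheta_2\leq\vartheta_3:=\sup\operatorname{supp}\mu<\infty$; (iii) $\nu((\alpha,\beta))=0$ provided that $\vartheta_2\leq\vartheta_3:=\sup\operatorname{supp}\mu<\infty$ and at least one of the following two conditions holds: (iii-a) either $\beta^\dag<\alpha^\dag$, or ($\beta^\dag\leq\alpha^\dag$ and $\varkappa\geq 3$), or ($\beta^\dag=\alpha^\dag$ and $\beta\in\operatorname{supp}\nu$); (iii-b) $\frac{\gamma}{\beta}\,\alpha<\alpha^\dag$ and $\beta\in\operatorname{supp}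\nu$.
   Context: $\mathbb{R}_+=[0,\infty)$. A sequence $\{a_n\}_{n=0}^\infty\subseteq\mathbb{R}_+$ is a Stieltjes moment sequence if there is a positive Borel measure $\mu$ on $\mathbb{R}_+$ with $a_n=\int_{\mathbb{R}_+}x^n\,d\mu(x)$ for all integers $n\geq 0$ (with $x^0=1$); such $\mu$ is called a representing measure of $\{a_n\}_{n=0}^\infty$. The sequence is determinate if it has a unique representing measure. $\operatorname{supp}$ denotes the closed support of a measure. An open interval $(s,t)$ with $s\geq t$ is empty. *)

(* Defs.v *)
From HB Require Import structures.
From mathcomp Require Import all_boot all_order all_algebra.
From mathcomp Require Import all_classical all_reals all_analysis.

Set Implicit Arguments.
Unset Strict Implicit.
Unset Printing Implicit Defensive.
Import Order.TTheory GRing.Theory Num.Theory.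
Import numFieldNormedType.Exports.
Local Open Scope classical_set_scope.
Local Open Scope ring_scope.

Notation borel_measure R :=
  {measure set (measurableTypeR R) -> \bar R}.

(* A Borel measure on [0, +oo[ is encoded as a Borel measure on the real line
   that does not charge ]-oo, 0[; no finiteness is assumed a priori (it follows
   from the n = 0 moment). *)
Definition representing_measure (R : realType) (a : nat -> R)
    (mu : borel_measure R) : Prop :=
  mu [set` `]-oo, (0 : R)[ ] = 0%E /\
  forall n : nat,
    (\int[mu]_(x in [set` `[(0 : R)%R, +oo[ ]) ((x : R) ^+ n)%:E = (a n)%:E)%E.

Definition stieltjes_moment_sequence (R : realType) (a : nat -> R) : Prop :=
  (forall n, 0 <= a n) /\
  exists mu : borel_measure R, representing_measure a mu.

(* Two measures are identified when they agree on all Borel sets: as functions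
   on arbitrary sets they may differ outside the sigma-algebra. *)
Definition determinate (R : realType) (a : nat -> R) : Prop :=
  exists mu : borel_measure R, representing_measure a mu /\
    forall mu' : borel_measure R, representing_measure a mu' ->
      forall A : set (measurableTypeR R), measurable A -> mu' A = mu A.

Definition closed_support (R : realType) (mu : borel_measure R) : set R :=
  [set x | forall U : set R, open U -> U x -> (0 < mu U)%E].

(* Only used for x >= 0 and k > 0, where it is the nonnegative k-th root. *)
Definition kroot (R : realType) (k : nat) (x : R) : R := x `^ (k%:R^-1).

(* Main.v *)
Require Import Defs.
From HB Require Import structures.
From mathcomp Require Import all_boot all_order all_algebra.
From mathcomp Require Import all_classical all_reals all_analysis.
From mathcomp Require Import measurable_realfun ring lra.

Import Order.TTheory GRing.Theory Num.Theory.
Import numFieldNormedType.Exports.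
Local Open Scope classical_set_scope.
Local Open Scope ring_scope.

(** Let sigma be the k-fold multiplicative convolution of nu, that is, the image
of the k-fold product measure of nu under (x_1, ..., x_k) |-> x_1 ... x_k. Its
n-th moment is the k-th power of the n-th moment of nu, namely a_n,
so sigma is again a representing measure of a. As soon as the moments a
determine their measure, sigma coincides with mu on Borel sets, and then every
product of k points of the support of nu lies in the support of mu, hence
outside ]theta1, theta2[ ([mul_convolution_pow], [support_expr3]). All the gaps
of nu are read off from this single fact, by choosing suitable products of at
most three distinct points.

Determinacy is a hypothesis in the first part. In the others it comes from the
boundedness of the support of mu ([bounded_support_determinate]): the moments
are then O(T^n), which by Markov's inequality confines every other representing
measure to [0, T]; and on a bounded interval the indicator of a ray is a bounded
pointwise limit of explicit polynomials ([cutoff_cvg]), so dominated convergence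
recovers the mass of each ray from the moments.

When sup supp mu = theta3 is finite, gamma = theta3^(1/k) is the largest point
of supp nu ([root_sup_support]), and it may be used as a factor:
- x^k forbids x in ]betad, beta[ ([gap_pow]);
- x gamma^(k-1) forbids x in ]alpha, alphad[ ([gap_top]);
- these two intervals may overlap; if they merely touch, at x = betad = alphad,
  the common endpoint is excluded by x^2 gamma^(k-2) when k >= 3
  ([gap_square]), and by x beta gamma^(k-2) when beta is in the support
  ([gap_next]);
- if beta is in the support, the k products x beta^(k-1-j) gamma^j forbid k
  intervals which overlap consecutively when theta1 gamma < theta2 beta, and
  which together cover ]alpha, beta[ ([gap_chain]). *)

Section StieltjesMeasures.
Set Implicit Arguments.
Unset Strict Implicit.
Variable R : realType.
Implicit Types (m : nat -> R) (mu nu rho : borel_measure R).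

(** * Measures on the half-line: moments, support and mass *)

Lemma kroot_ge0 (k : nat) (x : R) : 0 <= kroot k x.
Proof. exact: powR_ge0. Qed.

Lemma krootK (k : nat) (x : R) : (0 < k)%N -> 0 <= x ->
  kroot k x ^+ k = x.
Proof.
move=> k0 x0; rewrite -powR_mulrn ?kroot_ge0// -powRrM mulVf ?powRr1//.
by rewrite pnatr_eq0 -lt0n.
Qed.

Lemma measurable_expr_norm (n : nat) (D : set (measurableTypeR R)) :
  measurable_fun D ((fun x => (`|x : R| ^+ n)%:E) : measurableTypeR R -> \bar R).
Proof.
apply/measurable_EFinP; apply: measurable_funX.
exact: normr_measurable.
Qed.

(** Integrals over [0, +oo[ are turned into integrals over the whole line, where
pushforwards and Tonelli's theorem apply without restricting domains. *)
Lemma integral_halfline nu (f : R -> \bar R) :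
  nu [set` `]-oo, (0 : R)[ ] = 0%E ->
  measurable_fun setT (f : measurableTypeR R -> \bar R) ->
  (forall x, (0 <= f x)%E) ->
  (\int[nu]_(x in [set` `[(0 : R)%R, +oo[ ]) f x = \int[nu]_x f x)%E.
Proof.
move=> nu0 mf f0.
have mD (i : interval R) : measurable ([set` i] : set (measurableTypeR R)).
  exact: measurable_itv.
have -> : [set: measurableTypeR R] =
    [set` `[(0 : R)%R, +oo[ ] `|` [set` `]-oo, (0 : R)[ ].
  apply/esym/seteqP; split => // x _ /=; rewrite !in_itv/= andbT.
  by case: (leP 0 (x : R)) => h; [left|right].
rewrite ge0_integral_setU//=; last 2 first.
- exact: measurable_funTS mf.
- apply/disj_setPS => x /=; rewrite !in_itv/= andbT => -[x0 x1].
  by move: (lt_le_trans x1 x0); rewrite ltxx.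
rewrite [X in (_ = _ + X)%E]null_set_integral ?adde0//.
exact: measurable_funTS mf.
Qed.

(** The moments over [0, +oo[ are those of |x|^n over the line. Unlike x^n, the
function |x|^n is nonnegative everywhere and still multiplicative in x. *)
Lemma representing_norm m nu : representing_measure m nu ->
  forall n, (\int[nu]_x (`|x : R| ^+ n)%:E = (m n)%:E)%E.
Proof.
move=> [nu0 num] n; rewrite -num -integral_halfline//; last first.
  exact: measurable_expr_norm.
apply: eq_integral => x; rewrite inE/= in_itv/= andbT => x0.
by rewrite ger0_norm.
Qed.

Lemma representing_ge0 m nu n : representing_measure m nu -> 0 <= m n.
Proof.
move=> rep; rewrite -lee_fin -(representing_norm rep).
by apply: integral_ge0 => x _; rewrite lee_fin exprn_ge0.
Qed.

Lemma norm_representing m nu : nu [set` `]-oo, (0 : R)[ ] = 0%E ->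
  (forall n, (\int[nu]_x (`|x : R| ^+ n)%:E = (m n)%:E)%E) ->
  representing_measure m nu.
Proof.
move=> nu0 num; split => // n; rewrite -num -[RHS]integral_halfline//; last first.
  exact: measurable_expr_norm.
apply: eq_integral => x; rewrite inE/= in_itv/= andbT => x0.
by rewrite ger0_norm.
Qed.

Lemma representing_mass m nu : representing_measure m nu -> nu setT = (m 0%N)%:E.
Proof.
move=> /representing_norm/(_ 0%N) <-.
by under eq_integral do rewrite expr0; rewrite integral_cst//= mul1e.
Qed.

(** Product measures and Tonelli's theorem ask for finiteness as part of the type
of the measure; here it follows from the moment of order 0. *)
Lemma representing_finite m nu : representing_measure m nu ->
  exists nu' : {finite_measure set (measurableTypeR R) -> \bar R},
    forall A, nu' A = nu A.
Proof.
move=> /representing_mass nuT.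
have nuoo : (nu setT < +oo)%E by rewrite nuT ltry.
exists (mfrestr measurableT nuoo) => A.
by rewrite /= /mfrestr /mrestr setIT.
Qed.

Lemma off_support_null nu (x : R) : ~ closed_support nu x ->
  exists V : set R, [/\ open V, V x & nu V = 0%E].
Proof.
move=> nx; apply: contrapT => nV; apply: nx => V oV Vx.
rewrite lt0e measure_ge0 andbT; apply/eqP => V0.
by apply: nV; exists V.
Qed.

(** The line is second countable: a point off the support has a null
neighbourhood, which contains a null interval with rational endpoints around the
point, and there are only countably many such intervals. *)
Lemma open_null nu (U : set R) : open U ->
  (forall x, U x -> ~ closed_support nu x) -> nu U = 0%E.
Proof.
move=> oU US.
have mU : measurable (U : set (measurableTypeR R)) by exact: open_measurable.
apply: (measure_negligible mU).
pose I (pq : rat * rat) : set (measurableTypeR R) := [set` `]ratr pq.1, ratr pq.2[ ].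
pose F n : set (measurableTypeR R) := if unpickle n is Some pq then
  (if `[< nu (I pq) = 0%E >] then I pq else set0) else set0.
apply: (@negligibleS _ _ _ _ (\bigcup_n F n)); last first.
  apply: negligible_bigcup => n; rewrite /F.
  case: unpickle => [pq|]; last exact: negligible_set0.
  case: asboolP => [h|_]; last exact: negligible_set0.
  by apply/negligibleP => //; exact: measurable_itv.
move=> x Ux.
have [V [oV Vx V0]] := off_support_null (US x Ux).
have [e /= e0 eV] : nbhs x V by exact: open_nbhs_nbhs.
have [p pP] : exists p : rat, ratr p \in `]x - e, x[ by apply: rat_in_itvoo; lra.
have [q qP] : exists q : rat, ratr q \in `]x, x + e[ by apply: rat_in_itvoo; lra.
move: pP qP; rewrite !in_itv/= => /andP[p1 p2] /andP[q1 q2].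
exists (pickle (p, q)); first exact: Logic.I.
rewrite /F pickleK.
have Ix : I (p, q) x by rewrite /I/= in_itv/= p2 q1.
case: asboolP => // -[]; apply/eqP; rewrite eq_le measure_ge0 andbT.
rewrite -V0; apply: le_measure; rewrite ?inE//.
- exact: measurable_itv.
- exact: open_measurable.
- move=> y; rewrite /I/= in_itv/= => /andP[y1 y2]; apply: eV => /=.
  by rewrite ltr_norml; apply/andP; split; lra.
Qed.

Lemma support_ge0 nu x : nu [set` `]-oo, (0 : R)[ ] = 0%E ->
  closed_support nu x -> 0 <= x.
Proof.
move=> nu0 sx; rewrite leNgt; apply/negP => x0.
have oN : open ([set` `]-oo, (0 : R)[ ] : set R) by exact: interval_open.
by have := sx _ oN; rewrite nu0 ltxx /= in_itv/= x0 => /(_ isT).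
Qed.

Lemma markov_moment m nu (c : R) n : representing_measure m nu -> 0 <= c ->
  ((c ^+ n)%:E * nu [set` `[c, +oo[ ] <= (m n)%:E)%E.
Proof.
move=> [nu0 num] c0.
have mD (i : interval R) : measurable ([set` i] : set (measurableTypeR R)).
  exact: measurable_itv.
rewrite -integral_cst// -num.
have sub : [set` `[c, +oo[ ] `<=` [set` `[0, +oo[ ].
  by move=> x /=; rewrite !in_itv/= !andbT; exact: le_trans.
apply: (@le_trans _ _ (\int[nu]_(x in [set` `[c, +oo[ ]) ((x : R) ^+ n)%:E)%E).
  apply: ge0_le_integral => //.
  - by move=> x _; rewrite lee_fin exprn_ge0.
  - by apply/measurable_EFinP; exact: exprn_measurable.
  - move=> x /=; rewrite in_itv/= andbT lee_fin => cx.
    exact: lerXn2r (le_trans _ cx) cx.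
apply: ge0_subset_integral => //.
- by apply/measurable_EFinP; exact: exprn_measurable.
- by move=> x /=; rewrite in_itv/= andbT lee_fin => x0; rewrite exprn_ge0.
Qed.

(** For c > T, Markov's inequality bounds the mass of [c, +oo[ by C (T / c)^n for
every n, so this mass vanishes. *)
Lemma moment_bound_support m nu (C T : R) : representing_measure m nu -> 0 <= T ->
  (forall n, m n <= C * T ^+ n) -> nu [set` `]T, +oo[ ] = 0%E.
Proof.
move=> rep T0 mC.
rewrite itvoyEbigcup; apply: measure_negligible.
  by apply: bigcupT_measurable => j; exact: measurable_itv.
apply: negligible_bigcup => j; apply/negligibleP; first exact: measurable_itv.
set c := T + j.+1%:R^-1.
have cT : T < c by rewrite ltrDl invr_gt0 ltr0n.
have c0 : 0 < c by exact: le_lt_trans cT.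
have mc : measurable ([set` `[c, +oo[ ] : set (measurableTypeR R)).
  exact: measurable_itv.
have fin : nu [set` `[c, +oo[ ] \is a fin_num.
  rewrite ge0_fin_numE//; apply: (@le_lt_trans _ _ (nu setT)).
    by apply: le_measure; rewrite ?inE.
  by rewrite (representing_mass rep) ltry.
apply: (etrans (esym (fineK fin))); congr (_%:E); apply/eqP; rewrite eq_le.
rewrite fine_ge0// andbT.
have lim0 : C * (T / c) ^+ n @[n --> \oo] --> (0 : R).
  apply: cvg_geometric.
  by rewrite ger0_norm ?divr_ge0// ?ltW// ltr_pdivrMr// mul1r.
rewrite -(cvg_lim _ lim0)//; apply: limr_ge; first by apply/cvg_ex; exists 0.
apply: nearW => n.
have := markov_moment n rep (ltW c0).
rewrite -(fineK fin) -EFinM lee_fin => /le_trans/(_ (mC n)) h.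
by rewrite expr_div_n mulrA ler_pdivlMr ?exprn_gt0// mulrC.
Qed.

Lemma ae_bounded nu (T : R) : nu [set` `]-oo, (0 : R)[ ] = 0%E ->
  nu [set` `]T, +oo[ ] = 0%E ->
  {ae nu, forall x : measurableTypeR R, 0 <= (x : R) <= T}.
Proof.
move=> nu0 nuT; exists ([set` `]-oo, (0 : R)[ ] `|` [set` `]T, +oo[ ]); split.
- by apply: measurableU; exact: measurable_itv.
- by rewrite measureU0//; exact: measurable_itv.
- move=> x /=; rewrite !in_itv/= andbT => /negP.
  by rewrite negb_and -!ltNge => /orP.
Qed.

Lemma bounded_support_moment m nu (T : R) n : representing_measure m nu ->
  nu [set` `]T, +oo[ ] = 0%E -> 0 <= T -> m n <= m 0%N * T ^+ n.
Proof.
move=> rep nuT T0; rewrite -lee_fin -(representing_norm rep) mulrC EFinM.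
rewrite -(representing_mass rep) -integral_cst//.
apply: ae_ge0_le_integral => //.
- exact: measurable_expr_norm.
- by move=> x _; rewrite lee_fin exprn_ge0.
- apply: filterS (ae_bounded rep.1 nuT) => x /= /andP[x0 xT] _.
  rewrite lee_fin lerXn2r ?nnegrE// ger0_norm//.
Qed.

(** * Multiplicative convolution *)

Lemma measurable_mulR : measurable_fun setT
  (fun z : measurableTypeR R * measurableTypeR R =>
    (z.1 * z.2 : R) : measurableTypeR R).
Proof.
by apply: measurable_funM; [exact: measurable_fst|exact: measurable_snd].
Qed.

(** The measure is the image of the product measure under multiplication:
Tonelli's theorem multiplies the moments, and continuity of multiplication sends
a product of neighbourhoods, which has positive mass, into any given
neighbourhood of x * y. *)
Lemma mul_convolution m p nu rho :
  representing_measure m nu -> representing_measure p rho ->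
  exists sigma : borel_measure R,
    representing_measure (fun n => m n * p n) sigma /\
    forall x y, closed_support nu x -> closed_support rho y ->
      closed_support sigma (x * y).
Proof.
move=> repm repp.
have [nu' nuE] := representing_finite repm.
have [rho' rhoE] := representing_finite repp.
have measE (f g : borel_measure R) : (forall A, f A = g A) -> forall h,
    (\int[f]_x h x = \int[g]_x h x)%E.
  by move=> fg h; apply: eq_measure_integral => A _ _; exact: fg.
pose mulR := fun z : measurableTypeR R * measurableTypeR R =>
    (z.1 * z.2 : R) : measurableTypeR R.
have mmul : measurable_fun setT mulR := measurable_mulR.
have mpre (A : set (measurableTypeR R)) : measurable A -> measurable (mulR @^-1` A).
  by move=> mA; rewrite -[_ @^-1` _]setTI; exact: mmul.
have [sigma sigmaE] : exists sigma : borel_measure R,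
    sigma = pushforward (nu' \x rho')%E mulR :> (_ -> _).
  by unshelve eexists (pushforward (nu' \x rho')%E mulR : borel_measure R).
have prodE (A B : set (measurableTypeR R)) : measurable A -> measurable B ->
    (nu' \x rho')%E (A `*` B) = (nu A * rho B)%E.
  move=> mA mB; apply: (etrans (product_measure1E nu' rho' mA mB)).
  by congr (_ * _)%E; [exact: nuE|exact: rhoE].
exists sigma; split.
  apply: norm_representing.
    rewrite sigmaE /pushforward; apply: measure_negligible.
      by apply: mpre; exact: measurable_itv.
    (* A negative product has a negative factor. *)
    pose neg : set (measurableTypeR R) := [set` `]-oo, (0 : R)[ ].
    have mneg : measurable neg by exact: measurable_itv.
    apply: (@negligibleS _ _ _ _ (neg `*` setT `|` setT `*` neg)).
      move=> [x y]; rewrite /= !in_itv/= => xy.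
      case: (ltP (x : R) 0) => x0; first by left; rewrite /neg/= in_itv.
      right; rewrite /neg/= in_itv/=; split=> //; rewrite ltNge.
      by apply/negP => y0; have := lt_le_trans xy (mulr_ge0 x0 y0); rewrite ltxx.
    apply: negligibleU; apply/negligibleP.
    - exact: measurableX.
    - by apply: (etrans (prodE _ _ mneg measurableT)); rewrite repm.1 mul0e.
    - exact: measurableX.
    - by apply: (etrans (prodE _ _ measurableT mneg)); rewrite repp.1 mule0.
  move=> n.
  have mz : measurable_fun setT ((fun z : measurableTypeR R * measurableTypeR R =>
      (`|z.1 * z.2 : R| ^+ n)%:E) : _ -> \bar R).
    apply/measurable_EFinP; apply: measurable_funX.
    exact: measurableT_comp (@normr_measurable R setT) mmul.
  transitivity (\int[pushforward (nu' \x rho')%E mulR]_x (`|x : R| ^+ n)%:E)%E.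
    by congr (integral _ _ _).
  rewrite ge0_integral_pushforward//; last exact: measurable_expr_norm.
  rewrite preimage_setT (fubini_tonelli1 _ mz); last first.
    by move=> z; rewrite lee_fin exprn_ge0.
  transitivity (\int[nu']_x ((p n)%:E * (`|x : R| ^+ n)%:E))%E.
    apply: eq_integral => x _; rewrite /fubini_F/=.
    under eq_integral do rewrite normrM exprMn EFinM.
    rewrite ge0_integralZl//; last exact: measurable_expr_norm.
    rewrite muleC; congr (_ * _)%E.
    by rewrite (measE _ _ rhoE) (representing_norm repp).
  rewrite ge0_integralZl//; last 2 first.
  - exact: measurable_expr_norm.
  - by rewrite lee_fin (representing_ge0 _ repp).
  by rewrite (measE _ _ nuE) (representing_norm repm) -EFinM mulrC.
move=> x y sx sy U oU Uxy; rewrite sigmaE /pushforward.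
have [[A B] /= [nA nB] ABU] :=
  @mul_continuous R (x, y) U (open_nbhs_nbhs (conj oU Uxy)).
move: nA nB; rewrite !nbhsE => -[A' [oA Ax] AA] [B' [oB Bx] BB].
apply: (@lt_le_trans _ _ ((nu' \x rho')%E (A' `*` B'))).
  rewrite prodE; try exact: open_measurable.
  by rewrite mule_gt0; [|exact: sx|exact: sy].
apply: le_measure; rewrite ?inE.
- by apply: measurableX; exact: open_measurable.
- by apply: mpre; exact: open_measurable.
- by move=> [u v] [/= /AA Au /BB Bv]; exact: (ABU (u, v)).
Qed.

(** The recursion starts from the unit mass at 1, the neutral element of
multiplicative convolution. *)
Lemma mul_convolution_pow m nu : representing_measure m nu -> forall k : nat,
  exists sigma : borel_measure R,
    representing_measure (fun n => m n ^+ k) sigma /\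
    forall xs : seq R, size xs = k ->
      (forall x, x \in xs -> closed_support nu x) ->
      closed_support sigma (\prod_(x <- xs) x).
Proof.
move=> rep; elim=> [|k [sigma [reps supps]]].
  exists (dirac (1 : measurableTypeR R)); split.
    apply: norm_representing.
      rewrite /= /dirac indicE memNset//= in_itv/=; apply/negP.
      by rewrite -leNgt ler01.
    move=> n; rewrite integral_dirac//; last exact: measurable_expr_norm.
    by rewrite diracT mul1e normr1 expr1n expr0.
  move=> xs /size0nil -> _ U oU; rewrite big_nil => U1.
  by rewrite /= /dirac indicE mem_set// lte_fin ltr01.
have [tau [rept suppt]] := mul_convolution rep reps.
exists tau; split.
  by under eq_fun do rewrite exprS.
move=> [|x xs]//= [sz] sx; rewrite big_cons; apply: suppt.
  by apply: sx; rewrite mem_head.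
by apply: supps => // y yxs; apply: sx; rewrite in_cons yxs orbT.
Qed.

(** * Determinacy of measures with bounded support *)

Lemma expr1Bn_ge (u : R) (n : nat) : 0 <= u <= 1 -> 1 - n%:R * u <= (1 - u) ^+ n.
Proof.
move=> /andP[u0 u1]; elim: n => [|n IH]; first by rewrite mul0r subr0 expr0.
rewrite exprS; have : (1 - u) * (1 - n%:R * u) <= (1 - u) * (1 - u) ^+ n.
  by rewrite ler_wpM2l// subr_ge0.
apply: le_trans; rewrite -natr1.
have /[!mulrA] : 0 <= n%:R * (u * u) by rewrite !mulr_ge0.
by have := ler0n R n; nra.
Qed.

(** The factor 1 + n u is at most (1 + u)^n, and (1 + u) (1 - u) <= 1. *)
Lemma expr1Bn_le (u : R) (n : nat) : 0 <= u <= 1 ->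
  (1 + n%:R * u) * (1 - u) ^+ n <= 1.
Proof.
move=> /andP[u0 u1]; elim: n => [|n IH]; first by rewrite mul0r addr0 expr0 mul1r.
apply: le_trans IH; rewrite exprS mulrA ler_wpM2r ?exprn_ge0 ?subr_ge0//.
rewrite -natr1.
have /[!mulrA] : 0 <= n%:R * (u * u) by rewrite !mulr_ge0.
by have := ler0n R n; nra.
Qed.

(** With r the square root of q, the sequence n r^n is bounded by [expr1Bn_le] at
u = 1 - r, while the remaining factor r^n tends to 0. *)
Lemma cvg_natr_mulr_expr (q : R) : 0 <= q < 1 ->
  n%:R * q ^+ n @[n --> \oo] --> (0 : R).
Proof.
move=> /andP[q0 q1]; pose r := Num.sqrt q.
have r0 : 0 <= r by exact: sqrtr_ge0.
have r1 : r < 1 by rewrite -sqrtr1 ltr_sqrt.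
have lim0 : (1 - r)^-1 * r ^+ n @[n --> \oo] --> (0 : R).
  by apply: cvg_geometric; rewrite ger0_norm.
apply: (@squeeze_cvgr _ _ _ _ (cst 0) (fun n => (1 - r)^-1 * r ^+ n)) => //.
  apply: nearW => n; apply/andP; split; first by rewrite mulr_ge0 ?exprn_ge0.
  rewrite -(sqr_sqrtr q0) -/r -exprM mul2n -addnn exprD mulrA.
  rewrite ler_wpM2r ?exprn_ge0// -[leRHS]mul1r ler_pdivlMr ?subr_gt0//.
  have := @expr1Bn_le (1 - r) n; rewrite subKr.
  have -> : 0 <= 1 - r <= 1 by apply/andP; split; lra.
  move=> /(_ isT); have := exprn_ge0 n r0; set y := r ^+ n.
  by move=> y0; lra.
exact: cvg_cst.
Qed.

(** With L = n N^n one has L t^n = n (N t)^n, which tends to 0 if N t < 1 and is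
at least n if N t >= 1; correspondingly (1 - t^n)^L, which lies between
1 - L t^n and 1 / (1 + L t^n), tends to 1 or to 0. The factor n in the exponent
settles the threshold N t = 1, where N^n alone would produce the limit 1 / e. *)
Lemma cutoff_cvg (N : nat) (t : R) : 0 <= t <= 1 ->
  (1 - t ^+ n) ^+ (n * N ^ n) @[n --> \oo] --> (((N%:R * t < 1)%R)%:R : R).
Proof.
move=> t01; have /andP[t0 t1] := t01.
have tn01 n : 0 <= t ^+ n <= 1 by rewrite exprn_ge0//= exprn_ile1.
have Lt n : (n * N ^ n)%:R * t ^+ n = n%:R * (N%:R * t) ^+ n.
  by rewrite natrM natrX exprMn mulrA.
case: ltP => Nt.
  apply: (@squeeze_cvgr _ _ _ _ (fun n => 1 - n%:R * (N%:R * t) ^+ n) (cst 1)).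
  - apply: nearW => n; apply/andP; split; first by rewrite -Lt expr1Bn_ge.
    by have /andP[? ?] := tn01 n; rewrite exprn_ile1//; lra.
  - rewrite -[X in _ --> X]subr0; apply: cvgB; first exact: cvg_cst.
    by apply: cvg_natr_mulr_expr; rewrite Nt mulr_ge0.
  - exact: cvg_cst.
apply: (@squeeze_cvgr _ _ _ _ (cst 0) (fun n => n.+1%:R^-1)) => //.
- exists 1%N => // n /= n0; have /andP[u0 u1] := tn01 n.
  apply/andP; split; first by rewrite exprn_ge0// subr_ge0.
  have := expr1Bn_le (n * N ^ n) (tn01 n); rewrite Lt => h.
  rewrite -[leRHS]mul1r ler_pdivlMr// mulrC; apply: le_trans h.
  rewrite ler_wpM2r// ?exprn_ge0 ?subr_ge0//.
  rewrite -natr1 addrC lerD2l -[leLHS]mulr1 ler_wpM2l// exprn_ege1//.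
- exact: cvg_cst.
- exact: cvg_harmonic.
Qed.

(** Integrals of polynomials are functions of the moments alone. *)
Lemma integrable_horner m nu (p : {poly R}) : representing_measure m nu ->
  nu.-integrable [set` `[(0 : R)%R, +oo[ ] (fun x => (p.[x : R])%:E) /\
  (\int[nu]_(x in [set` `[(0 : R)%R, +oo[ ]) (p.[x : R])%:E =
    (\sum_(i < size p) p`_i * m i)%:E)%E.
Proof.
move=> [nu0 num].
have mD : measurable ([set` `[(0 : R)%R, +oo[ ] : set (measurableTypeR R)).
  exact: measurable_itv.
have intX (i : nat) : nu.-integrable [set` `[(0 : R)%R, +oo[ ]
    ((fun x => ((x : R) ^+ i)%:E) : measurableTypeR R -> \bar R).
  apply/integrableP; split.
    by apply/measurable_EFinP; exact: exprn_measurable.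
  under eq_integral => x xD.
    have x0 : 0 <= (x : R) by move: xD; rewrite inE/= in_itv/= andbT.
    rewrite gee0_abs ?lee_fin ?exprn_ge0//; over.
  by rewrite num ltry.
have intc (i : nat) : nu.-integrable [set` `[(0 : R)%R, +oo[ ]
    ((fun x => (p`_i)%:E * ((x : R) ^+ i)%:E)%E : measurableTypeR R -> \bar R).
  exact: integrableZl.
have hE : (fun x : measurableTypeR R => (p.[x : R])%:E) =
    (fun x => \sum_(i < size p) ((p`_i)%:E * ((x : R) ^+ i)%:E)%E).
  apply/funext => x; rewrite horner_coef -sumEFin.
  by apply: eq_bigr => i _; rewrite EFinM.
rewrite hE; split; first by apply: integrable_sum.
rewrite integral_sum// -sumEFin; apply: eq_bigr => i _.
by rewrite integralZl// num EFinM.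
Qed.

(** After rescaling by c N, the cutoff polynomials of [cutoff_cvg] have their
threshold at c and are bounded by 1 on [0, c N], which carries the measure.
As the left-hand side depends on the moments only, two measures with the same
moments give the same mass to the ray. *)
Lemma cvg_cutoff_moments m nu (c T : R) (N : nat) : representing_measure m nu ->
  nu [set` `]T, +oo[ ] = 0%E -> 0 < c -> T <= c * N%:R -> (0 < N)%N ->
  let p n : {poly R} := (1 - ((c * N%:R)^-1 *: 'X) ^+ n) ^+ (n * N ^ n) in
  (\sum_(i < size (p n)) (p n)`_i * m i)%:E @[n --> \oo] -->
    nu [set` `]-oo, c[ ].
Proof.
move=> rep nuT c0 TcN N0 p.
have cN0 : 0 < c * N%:R by rewrite mulr_gt0 ?ltr0n.
set D : set (measurableTypeR R) := [set` `[(0 : R)%R, +oo[ ].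
have mD : measurable D by exact: measurable_itv.
have mray : measurable ([set` `]-oo, c[ ] : set (measurableTypeR R)).
  exact: measurable_itv.
have mneg : measurable ([set` `]-oo, (0 : R)[ ] : set (measurableTypeR R)).
  exact: measurable_itv.
have -> : nu [set` `]-oo, c[ ] =
    (\int[nu]_(x in D) (\1_([set` `]-oo, c[ ] : set (measurableTypeR R)) x)%:E)%E.
  rewrite integral_indic//.
  transitivity (nu (([set` `]-oo, c[ ] `&` D) `|` [set` `]-oo, (0 : R)[ ])).
    congr (nu _); apply/seteqP; split => x /=; rewrite !in_itv/= ?andbT.
      move=> xc; case: (leP 0 (x : R)) => x0; [left; split=> //|by right].
      by rewrite /D/= in_itv/= x0.
    by move=> [[]//|x0]; exact: lt_trans c0.
  by rewrite measureU0//; [exact: measurableI|exact: rep.1].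
have pE n : (\sum_(i < size (p n)) (p n)`_i * m i)%:E =
    (\int[nu]_(x in D) ((p n).[x : R])%:E)%E.
  by have [_ ->] := integrable_horner (p n) rep.
under eq_cvg do rewrite pE.
have hp n (x : R) :
    (p n).[x] = (1 - ((c * N%:R)^-1 * x) ^+ n) ^+ (n * N ^ n).
  by rewrite /p !hornerE.
have /= := @dominated_convergence _ _ _ nu D mD
  (fun n x => ((p n).[x : R])%:E)
  (fun x => (\1_([set` `]-oo, c[ ] : set (measurableTypeR R)) x)%:E) (cst 1%E).
have t01 (x : R) : 0 <= x <= T -> 0 <= (c * N%:R)^-1 * x <= 1.
  move=> /andP[x0 xT]; rewrite mulr_ge0 ?invr_ge0// ?(ltW cN0)//=.
  by rewrite ler_pdivrMl// mulr1 (le_trans xT).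
case=> //.
- by move=> n; have [/measurable_int] := integrable_horner (p n) rep.
- by apply/measurable_EFinP; exact: measurable_indic.
- apply: filterS (ae_bounded rep.1 nuT) => x /t01 tx _.
  apply/cvg_EFin; first exact: nearW.
  under eq_cvg do rewrite /= hp.
  have -> : \1_([set` `]-oo, c[ ] : set (measurableTypeR R)) x =
      ((N%:R * ((c * N%:R)^-1 * (x : R)) < 1)%R)%:R :> R.
    rewrite indicE mem_setE in_itv/=; congr (_%:R); congr nat_of_bool.
    have N0' : 0 < N%:R :> R by rewrite ltr0n.
    by rewrite invfM mulrA mulrCA mulfV ?gt_eqF// mulr1 mulrC ltr_pdivrMr// mul1r.
  exact: cutoff_cvg.
- apply/integrableP; split; first exact: measurable_cst.
  rewrite (eq_integral (cst 1%E)); last by move=> x _; rewrite /= normr1.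
  rewrite integral_cst// mul1e; apply: (@le_lt_trans _ _ (nu setT)).
    by apply: le_measure; rewrite ?inE.
  by rewrite (representing_mass rep) ltry.
- apply: filterS (ae_bounded rep.1 nuT) => x /t01 /andP[t0 t1] n _.
  rewrite lee_fin hp ger0_norm; last by rewrite exprn_ge0// subr_ge0 exprn_ile1.
  rewrite exprn_ile1// ?subr_ge0 ?exprn_ile1//.
  by rewrite lerBlDr lerDl exprn_ge0.
Qed.

(** The growth of the moments transfers the bound on the support from mu to rho;
the limits of the cutoff integrals then show that the two measures agree on the
rays ]-oo, c[, a pi-system generating the Borel sets. *)
Lemma bounded_support_determinate m mu rho (T : R) :
  representing_measure m mu -> representing_measure m rho -> 0 <= T ->
  mu [set` `]T, +oo[ ] = 0%E ->
  forall A : set (measurableTypeR R), measurable A -> mu A = rho A.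
Proof.
move=> repmu reprho T0 muT.
have rhoT : rho [set` `]T, +oo[ ] = 0%E.
  apply: (moment_bound_support reprho T0 (C := m 0%N)) => n.
  exact: bounded_support_moment repmu muT T0.
have rays (c : R) : mu [set` `]-oo, c[ ] = rho [set` `]-oo, c[ ].
  have [c0|c0] := leP c 0.
    have null nu' : representing_measure m nu' -> nu' [set` `]-oo, c[ ] = 0%E.
      move=> rep; apply/eqP; rewrite eq_le measure_ge0 andbT -rep.1.
      apply: le_measure; rewrite ?inE; try exact: measurable_itv.
      by move=> x /=; rewrite !in_itv/= => /lt_le_trans; apply.
    by rewrite !null.
  pose N := (Num.truncn (T / c)).+1.
  have TcN : T <= c * N%:R.
    by rewrite mulrC -ler_pdivrMr// ltW// truncnS_gt.
  have h1 := cvg_cutoff_moments repmu muT c0 TcN (ltn0Sn _).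
  have h2 := cvg_cutoff_moments reprho rhoT c0 TcN (ltn0Sn _).
  exact: cvg_unique h1 h2.
apply: (@measure_unique _ R (measurableTypeR R) (@RGenInftyO.G R)
  (fun n => [set` `]-oo, (n%:R : R)[ ]) _ _ _ _ mu rho).
- exact: RGenInftyO.measurableE.
- move=> _ _ [x ->] [y ->]; exists (Num.min x y).
  by apply/seteqP; split => z /=; rewrite !in_itv/= lt_min => /andP.
- by move=> n; exists n%:R.
- apply/seteqP; split => // x _; exists (Num.truncn (Num.max x 0)).+1 => //=.
  rewrite in_itv/= (@le_lt_trans _ _ (Num.max x 0)) ?truncnS_gt//.
  by rewrite le_max lexx.
- by move=> _ [c ->]; exact: rays.
- move=> n; apply: (@le_lt_trans _ _ (mu setT)).
    by apply: le_measure; rewrite ?inE//; exact: measurable_itv.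
  by rewrite (representing_mass repmu) ltry.
Qed.

(** * Products of support points *)

Lemma support_gap mu (s t z : R) : mu [set` `]s, t[ ] = 0%E ->
  closed_support mu z -> ~ (s < z < t).
Proof.
move=> mu0 sz szt.
have oI : open ([set` `]s, t[ ] : set R) by exact: interval_open.
by have := sz _ oI; rewrite mu0 ltxx /= in_itv/= szt => /(_ isT).
Qed.

(** Three distinct factors are enough for all the products needed below; the
hypothesis on sigma is determinacy of the moments a, with mu as solution. *)
Lemma support_expr3 (a : nat -> R) mu nu (k : nat) :
  (0 < k)%N -> (forall n, 0 <= a n) ->
  representing_measure (fun n => kroot k (a n)) nu ->
  (forall sigma : borel_measure R, representing_measure a sigma ->
    forall A : set (measurableTypeR R), measurable A -> sigma A = mu A) ->
  forall x y z i j l, closed_support nu x -> closed_support nu y ->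
    closed_support nu z -> (i + j + l)%N = k ->
    closed_support mu (x ^+ i * y ^+ j * z ^+ l).
Proof.
move=> k0 a0 repnu det x y z i j l sx sy sz ijl.
have [sigma [repsigma prods]] := mul_convolution_pow repnu k.
have {}repsigma : representing_measure a sigma.
  by move: repsigma; under eq_fun do rewrite krootK//.
move=> U oU Uxyz; rewrite -(det _ repsigma); last first.
  exact: open_measurable.
apply: (prods (nseq i x ++ nseq j y ++ nseq l z)) oU _.
- by rewrite !size_cat !size_nseq addnA.
- by move=> w; rewrite !mem_cat !mem_nseq => /or3P[] /andP[_ /eqP->].
- by rewrite !big_cat/= !big_nseq !iter_mulr_1 mulrA.
Qed.

(** If g were not in the support of nu, then nu would live on [0, b] for some
b < g; its moments would be O(b^n), those of mu O((b^k)^n), and mu would live on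
[0, b^k], below the supremum g^k of its support. *)
Lemma root_sup_support (a : nat -> R) mu nu (k : nat) (g : R) :
  (0 < k)%N -> (forall n, 0 <= a n) -> representing_measure a mu ->
  representing_measure (fun n => kroot k (a n)) nu -> 0 < g ->
  (forall x, closed_support nu x -> x <= g) ->
  ereal_sup [set x%:E | x in closed_support mu] = (g ^+ k)%:E ->
  closed_support nu g.
Proof.
move=> k0 a0 repmu repnu g0 supg supmu; apply: contrapT => ng.
have [U [oU Ug U0]] := off_support_null ng.
have [e /= e0 eU] : nbhs g U by exact: open_nbhs_nbhs.
(* The truncation at 0 makes powers of b monotone and keeps b < g. *)
pose b := Num.max (g - e) 0.
have b0 : 0 <= b by rewrite le_max lexx orbT.
have bg : b < g by rewrite gt_max g0 andbT; lra.
have nub : nu [set` `]b, +oo[ ] = 0%E.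
  apply: open_null; first exact: interval_open.
  move=> x /=; rewrite in_itv/= andbT gt_max => /andP[xe x0] sx.
  suff Ux : U x by have := sx U oU Ux; rewrite U0 ltxx.
  apply: eU => /=.
  by have := supg _ sx; rewrite ltr_norml => xg; apply/andP; split; lra.
have mub : mu [set` `]b ^+ k, +oo[ ] = 0%E.
  apply: (moment_bound_support repmu (exprn_ge0 k b0) (C := a 0%N)) => n.
  rewrite -exprM mulnC exprM -(krootK k0 (a0 n)) -(krootK k0 (a0 0%N)) -exprMn.
  rewrite lerXn2r ?nnegrE ?kroot_ge0 ?mulr_ge0 ?exprn_ge0 ?kroot_ge0//.
  exact: bounded_support_moment repnu nub b0.
have : ((g ^+ k)%:E <= (b ^+ k)%:E)%E.
  rewrite -supmu; apply: ge_ereal_sup => _ [x sx <-]; rewrite lee_fin leNgt.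
  apply/negP => bx.
  have oI : open ([set` `]b ^+ k, +oo[ ] : set R) by exact: interval_open.
  by have := sx _ oI; rewrite mub ltxx /= in_itv/= bx => /(_ isT).
by rewrite lee_fin leNgt ltrXn2r// -lt0n k0.
Qed.

(** * Arithmetic of a set whose products avoid an interval *)

(** S stands for the support of nu. Each exclusion argument multiplies copies of
the point to exclude with copies of at most two known points of S. *)
Definition product_gap (S : set R) (k : nat) (s t : R) : Prop :=
  forall x y z i j l, S x -> S y -> S z -> (i + j + l)%N = k ->
    ~ (s < x ^+ i * y ^+ j * z ^+ l < t).

Lemma gap_pow (S : set R) (k : nat) (s t x : R) :
  product_gap S k (s ^+ k) (t ^+ k) -> (0 < k)%N -> 0 <= s -> S x ->
  ~ (s < x < t).
Proof.
move=> gap k0 s0 Sx /andP[sx xt].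
apply: (gap x x x k 0 0)%N; rewrite ?addn0// !expr0 !mulr1.
have x0 := le_lt_trans s0 sx.
by rewrite !ltr_pXn2r ?nnegrE ?sx ?xt// ltW// (lt_trans x0).
Qed.

Lemma gap_top (S : set R) (k : nat) (s t g x : R) :
  product_gap S k s t -> (0 < k)%N -> S g -> S x ->
  ~ (s < x * g ^+ k.-1 < t).
Proof.
move=> gap k0 Sg Sx H; apply: (gap x x g 1 0 k.-1)%N => //.
  by rewrite addn0 add1n prednK.
by rewrite expr1 expr0 mulr1.
Qed.

(** Here the interval runs from x^k to x g^(k-1), and x^2 g^(k-2) lies strictly
between its endpoints; for k = 2 it would be the left endpoint. *)
Lemma gap_square (S : set R) (k : nat) (g x : R) :
  product_gap S k (x ^+ k) (x * g ^+ k.-1) -> (3 <= k)%N -> S g ->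
  0 < x -> x < g -> ~ S x.
Proof.
case: k => [|[|[|k]]]// gap _ Sg x0 xg Sx.
have g0 := lt_trans x0 xg.
apply: (gap x x g 2 0 k.+1)%N => //=.
rewrite expr0 mulr1; apply/andP; split.
  rewrite -[k.+3]/(2 + k.+1)%N exprD ltr_pM2l ?exprn_gt0//.
  by rewrite ltrXn2r// ltW.
by rewrite [in ltRHS]exprS expr2 -mulrA ltr_pM2l// ltr_pM2r ?exprn_gt0.
Qed.

(** The product x b g^(k-2) lies strictly between x^k and x g^(k-1). *)
Lemma gap_next (S : set R) (k : nat) (b g x : R) :
  product_gap S k (x ^+ k) (x * g ^+ k.-1) -> (2 <= k)%N -> S b -> S g ->
  0 < x -> x < b -> b < g -> ~ S x.
Proof.
case: k => [|[|k]]// gap _ Sb Sg x0 xb bg Sx.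
have xg := lt_trans xb bg; have g0 := lt_trans x0 xg.
apply: (gap x b g 1 1 k)%N => //=.
rewrite !expr1 exprS -!mulrA !ltr_pM2l//; apply/andP; split.
  rewrite exprS; apply: (@lt_le_trans _ _ (b * x ^+ k)).
    by rewrite ltr_pM2r ?exprn_gt0.
  by rewrite ler_pM2l ?(lt_trans x0)// lerXn2r// ?nnegrE ltW.
by rewrite exprS ltr_pM2r ?exprn_gt0.
Qed.

(** The products x b^(k-1-j) g^j avoid ]s, b^k[. The one with j = 0 is less than
b^k, hence at most s; passing from j to j + 1 multiplies by g / b, and
s (g / b) < b^k, so the next product is below b^k too, hence again at most s. *)
Lemma gap_chain (S : set R) (k : nat) (s b g x : R) :
  product_gap S k s (b ^+ k) -> (0 < k)%N -> S b -> S g -> 0 < b -> 0 <= g ->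
  s * g < b ^+ k * b -> x < b -> S x -> x * g ^+ k.-1 <= s.
Proof.
case: k => [|k]// gap _ Sb Sg b0 g0 sgb xb Sx.
have avoid j : (j <= k)%N -> x * b ^+ (k - j) * g ^+ j < b ^+ k.+1 ->
    x * b ^+ (k - j) * g ^+ j <= s.
  move=> jk lt; rewrite leNgt; apply/negP => gt.
  apply: (gap x b g 1 (k - j) j)%N => //; first by rewrite -addnA subnK.
  by rewrite expr1 gt lt.
have step j : (j <= k)%N -> x * b ^+ (k - j) * g ^+ j <= s.
  elim: j => [|j IH] jk.
    apply: avoid => //; rewrite subn0 expr0 mulr1 exprS ltr_pM2r//.
    by rewrite exprn_gt0.
  apply: avoid => //; rewrite -(ltr_pM2r b0); apply: le_lt_trans sgb.
  have -> : x * b ^+ (k - j.+1) * g ^+ j.+1 * b = (x * b ^+ (k - j) * g ^+ j) * g.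
    by rewrite -(subnSK jk) !exprS; ring.
  by rewrite ler_wpM2r// IH// ltnW.
by have := step k (leqnn k); rewrite subnn expr0 mulr1.
Qed.

End StieltjesMeasures.

Theorem theorem5p3 (R : realType) (k : nat) (hk : (2 <= k)%N)
    (a : nat -> R) (mu nu : borel_measure R)
    (ha : stieltjes_moment_sequence a)
    (hmu : representing_measure a mu)
    (hroot : stieltjes_moment_sequence (fun n => kroot k (a n)))
    (hnu : representing_measure (fun n => kroot k (a n)) nu)
    (theta1 theta2 : R) (h1 : 0 <= theta1) (h12 : theta1 < theta2)
    (hgap : mu [set` `]theta1, theta2[ ] = 0%E) :
  let beta := kroot k theta2 in
  let betad := kroot k theta1 in
  (determinate a -> nu [set` `]betad, beta[ ] = 0%E)
  /\
  (forall theta3 : R,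
    ereal_sup [set x%:E | x in closed_support mu] = theta3%:E ->
    theta2 <= theta3 ->
    let alpha := theta1 / theta3 * kroot k theta3 in
    let gamma := kroot k theta3 in
    let alphad := theta2 / theta3 * kroot k theta3 in
    nu [set` `]alpha, alphad[ ] = 0%E
    /\
    (((betad < alphad
       \/ (betad <= alphad /\ (3 <= k)%N)
       \/ (betad = alphad /\ closed_support nu beta))
      \/
      (gamma / beta * alpha < alphad /\ closed_support nu beta)) ->
     nu [set` `]alpha, beta[ ] = 0%E)).
Proof.
move=> beta betad.
have k0 : (0 < k)%N by exact: ltn_trans hk.
have a0 : forall n, 0 <= a n := ha.1.
have th2 : 0 < theta2 by exact: le_lt_trans h12.
have betak : beta ^+ k = theta2 by rewrite krootK// ltW.
have betadk : betad ^+ k = theta1 by rewrite krootK.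
have betad0 : 0 <= betad by exact: kroot_ge0.
have null (s t : R) : (forall x, closed_support nu x -> ~ (s < x < t)) ->
    nu [set` `]s, t[ ] = 0%E.
  move=> gap; apply: open_null; first exact: interval_open.
  by move=> x /=; rewrite in_itv/= => sxt sx; exact: gap sxt.
have prod_gap : (forall sigma : borel_measure R, representing_measure a sigma ->
      forall A : set (measurableTypeR R), measurable A -> sigma A = mu A) ->
    product_gap (closed_support nu) k theta1 theta2.
  move=> det x y z i j l sx sy sz ijl.
  exact: support_gap hgap (support_expr3 k0 a0 hnu det sx sy sz ijl).
split=> [[mu0 [_ det0]]|theta3 sup3 th23 alpha gamma alphad].
  apply: null => x; apply: gap_pow k0 betad0; rewrite betadk betak.
  by apply: prod_gap => sigma rep A mA; rewrite !det0.
have th3 : 0 < theta3 by exact: lt_le_trans th23.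
have mule x : closed_support mu x -> x <= theta3.
  by move=> sx; rewrite -lee_fin -sup3; apply: ereal_sup_ubound; exists x.
have mu3 : mu [set` `]theta3, +oo[ ] = 0%E.
  apply: open_null; first exact: interval_open.
  by move=> x /=; rewrite in_itv/= andbT => x3 /mule; rewrite leNgt x3.
have det (sigma : borel_measure R) : representing_measure a sigma ->
    forall A : set (measurableTypeR R), measurable A -> sigma A = mu A.
  move=> rep A mA; apply/esym.
  exact: bounded_support_determinate hmu rep (ltW th3) mu3 _ mA.
have {prod_gap} gap := prod_gap det.
have gammak : gamma ^+ k = theta3 by rewrite krootK// ltW.
have gamma0 : 0 < gamma by rewrite powR_gt0.
have beta0 : 0 < beta by rewrite powR_gt0.
have nug x : closed_support nu x -> x <= gamma.
  move=> sx; have x0 : 0 <= x := support_ge0 hnu.1 sx.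
  rewrite -(ler_pXn2r k0) ?nnegrE ?(ltW gamma0)// gammak; apply: mule.
  have := support_expr3 k0 a0 hnu det sx sx sx (_ : k + 0 + 0 = k)%N.
  by rewrite !expr0 !mulr1 !addn0; apply.
have sgamma : closed_support nu gamma.
  by apply: (root_sup_support k0 a0 hmu hnu) => //; rewrite gammak.
have gk0 : 0 < gamma ^+ k.-1 by rewrite exprn_gt0.
have gammaE : gamma ^+ k.-1 * gamma = theta3 by rewrite -exprSr prednK.
have alphaE : alpha * gamma ^+ k.-1 = theta1.
  by rewrite /alpha -/gamma -mulrA (mulrC gamma) gammaE divfK// gt_eqF.
have alphadE : alphad * gamma ^+ k.-1 = theta2.
  by rewrite /alphad -/gamma -mulrA (mulrC gamma) gammaE divfK// gt_eqF.
have top x : closed_support nu x -> ~ (alpha < x < alphad).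
  move=> sx; have := gap_top gap k0 sgamma sx.
  by rewrite -{1}alphaE -alphadE !ltr_pM2r.
split; first exact: null.
have pow x : closed_support nu x -> ~ (betad < x < beta).
  by apply: gap_pow k0 betad0; rewrite betadk betak.
have bg : beta <= gamma by rewrite -(ler_pXn2r k0) ?nnegrE ?kroot_ge0// betak gammak.
move=> H; apply: null => x sx /andP[ax xb].
case: H => [H|[hab sbeta]]; last first.
  have : x * gamma ^+ k.-1 <= theta1.
    apply: (gap_chain (S := closed_support nu) (b := beta)) => //.
    - by rewrite betak.
    - exact: ltW.
    move: hab; rewrite -(ltr_pM2r gk0) alphadE -[_ * alpha * _]mulrA alphaE betak.
    by rewrite mulrAC ltr_pdivrMr// (mulrC gamma).
  by rewrite -alphaE ler_pM2r// leNgt ax.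
(* Off both gaps, x lies between alphad and betad, which the hypothesis allows
   only if the three coincide. *)
have adx : alphad <= x.
  by rewrite leNgt; apply/negP => xad; apply: (top x sx); rewrite ax.
have xbd : x <= betad.
  by rewrite leNgt; apply/negP => bx; apply: (pow x sx); rewrite bx.
have bdad : betad <= alphad by case: H => [/ltW|[[]|[->]]].
have xE : x = betad by apply/eqP; rewrite eq_le xbd (le_trans bdad).
have xE' : x = alphad by apply/eqP; rewrite eq_le adx (le_trans xbd).
have {}gap : product_gap (closed_support nu) k (x ^+ k) (x * gamma ^+ k.-1).
  by rewrite {1}xE betadk xE' alphadE.
have x0 : 0 < x.
  by rewrite xE' -(ltr_pM2r gk0) mul0r alphadE.
case: H => [|[[_ k3]|[_ sbeta]]].
- by rewrite -xE -xE' ltxx.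
- exact: gap_square gap k3 sgamma x0 (lt_le_trans xb bg) sx.
have [bg'|gb] := ltP beta gamma.
  exact: gap_next gap hk sbeta sgamma x0 xb bg' sx.
have bE : beta = gamma by apply/eqP; rewrite eq_le bg.
move: xb; rewrite xE' -(ltr_pM2r gk0) alphadE bE -exprS prednK// -bE betak.
by rewrite ltxx.
Qed.
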